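(* Let $f(W,\theta')=W\,h(\theta')$ for $W\in\mathbb R^{c\times s}$ and $\theta'\in\mathbb R^{d'}$, where $h:\mathbb R^{d'}\to\mathbb R^s$ is such that $f$ is smooth; let $\ell:\mathbb R^c\to\mathbb R$ be smooth and $L=\ell\circ f$. Let $\theta=(W,\theta')$. Then for any $V\in\mathbb R^{c\times s}$ whose row space is contained in the row space of $W$, $$\big\langle\mathrm{vec}\,V,\;\nabla^2_{\mathrm{vec}\,W}L(\theta)\,\mathrm{vec}\,V\big\rangle=\big\langle V\mathbf h,\;\nabla^2\ell(\mathbf y)\,V\mathbf h\big\rangle,$$ where $\mathbf h=h(\theta')$ and $\mathbf y=f(\theta)=W\mathbf h$.
   Context: $W$ is the last-layer weight matrix and $\theta'$ the remaining parameters. $\mathrm{vec}$ denotes vectorization of a matrix, and $\nabla^2_{\mathrm{vec}\,W}L(\theta)$ is the $cs\times cs$ Hessian of $L$ with respect to $\mathrm{vec}\,W$, with $\theta'$ held fixed. Inner products are Euclidean. *)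

(* Defs.v *)
From HB Require Import structures.
From mathcomp Require Import all_boot all_order all_algebra.
From mathcomp Require Import all_classical all_reals.
From mathcomp Require Import topology normedtype derive.

Set Implicit Arguments.
Unset Strict Implicit.
Unset Printing Implicit Defensive.

Import Order.TTheory GRing.Theory Num.Theory.
Import numFieldNormedType.Exports.

Local Open Scope classical_set_scope.
Local Open Scope ring_scope.

(* Between finite-dimensional spaces, continuity of all the maps x |-> 'D_v f x
   is continuity of x |-> 'd f x, so this is the usual class C^k. *)
Fixpoint class_C (R : realType) (U V : normedModType R) (k : nat)
    (f : U -> V) : Prop :=
  if k is k'.+1 then
    (forall x, differentiable f x) /\ (forall v, class_C k' ('D_v f))
  else continuous f.

Definition smooth (R : realType) (U V : normedModType R) (f : U -> V) : Prop :=
  forall k, class_C k f.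

Definition dotp (R : realType) (n : nat) (u v : 'cV[R]_n) : R :=
  \sum_(i < n) u i 0 * v i 0.

(* [mxvec] is row-major, so the transpose gives the usual column-stacking vec. *)
Definition vec (R : realType) (m n : nat) (A : 'M[R]_(m, n)) : 'cV[R]_(n * m) :=
  (mxvec A^T)^T.

Definition unvec (R : realType) (m n : nat) (v : 'cV[R]_(n * m)) : 'M[R]_(m, n) :=
  (vec_mx v^T)^T.

Lemma vecK (R : realType) (m n : nat) : cancel (@vec R m n) (@unvec R m n).
Proof. by move=> A; rewrite /unvec /vec trmxK mxvecK trmxK. Qed.

Lemma unvecK (R : realType) (m n : nat) : cancel (@unvec R m n) (@vec R m n).
Proof. by move=> v; rewrite /unvec /vec trmxK vec_mxK trmxK. Qed.

Definition hessian (R : realType) (n : nat) (g : 'cV[R]_n -> R) (x : 'cV[R]_n) :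
    'M[R]_n :=
  \matrix_(i, j) 'D_(delta_mx i 0) ('D_(delta_mx j 0) g) x.

Definition hessian_vecW (R : realType) (c s d : nat)
    (L : 'M[R]_(c, s) * 'cV[R]_d -> R) (theta : 'M[R]_(c, s) * 'cV[R]_d) :
    'M[R]_(s * c) :=
  hessian (fun w => L (unvec w, theta.2)) (vec theta.1).

(* Main.v *)
(** In the direction of vec W, L is l composed with the linear map
    w |-> unvec w *m h theta', which sends vec V to V *m h theta'. Both sides are
    therefore the second derivative of l at y along V *m h theta'. *)
From HB Require Import structures.
Require Import Defs.
From mathcomp Require Import all_boot all_order all_algebra.
From mathcomp Require Import all_classical all_reals.
From mathcomp Require Import topology normedtype derive.

Set Implicit Arguments.
Unset Strict Implicit.
Unset Printing Implicit Defensive.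

Import Order.TTheory GRing.Theory Num.Theory.
Import numFieldNormedType.Exports.

Local Open Scope ring_scope.

(* No chain rule is needed: for linear [A] the two difference quotients coincide. *)
Lemma derive_comp_linear (R : realType) (U V W : normedModType R)
    (A : {linear U -> V}) (l : V -> W) (v x : U) :
  'D_v (l \o A) x = 'D_(A v) l (A x).
Proof.
rewrite /derive /=.
by under eq_fun do rewrite linearP.
Qed.

(** Differentiability identifies ['D_v l x] with the differential ['d l x] applied to [v], which is
    linear in [v]. *)
Lemma derive_sumZ (R : realType) (U V : normedModType R) (n : nat)
    (l : U -> V) (a : 'I_n -> U) (u : 'I_n -> R) (x : U) :
  differentiable l x ->
  'D_(\sum_i u i *: a i) l x = \sum_i u i *: 'D_(a i) l x.
Proof.
move=> dl; rewrite deriveE // linear_sum.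
by apply: eq_bigr => i _; rewrite linearZ deriveE.
Qed.

Lemma derive2_sumZ (R : realType) (U V : normedModType R) (n : nat)
    (l : U -> V) (a : 'I_n -> U) (u : 'I_n -> R) (x : U) :
  class_C 2 l ->
  let v := \sum_i u i *: a i in
  'D_v ('D_v l) x = \sum_i \sum_j (u i * u j) *: 'D_(a i) ('D_(a j) l) x.
Proof.
move=> [dl Cl] v.
have dDl w y : differentiable ('D_w l) y by have [] := Cl w.
rewrite derive_sumZ //; apply: eq_bigr => i _.
(* The inner derivative is expanded as an identity of functions, at every point [y], because it is
   differentiated once more along [a i]. *)
have -> : 'D_v l = \sum_j u j *: 'D_(a j) l.
  by apply/funext => y; rewrite derive_sumZ // fct_sumE.
have dd j : derivable ('D_(a j) l) x (a i) by exact: diff_derivable.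
rewrite derive_sum => [|j]; last exact: derivableZ.
by rewrite scaler_sumr; apply: eq_bigr => j _; rewrite deriveZ // scalerA.
Qed.

(** Expanding [u] in the canonical basis writes [A u] as a combination of the images
    [A (delta_mx i 0)]; by bilinearity of the second derivative, its coefficients along these images
    are the entries of the Hessian of [l \o A]. *)
Lemma dotp_hessian_comp_linear (R : realType) (n : nat) (V : normedModType R)
    (A : {linear 'cV[R]_n -> V}) (l : V -> R) (u x : 'cV[R]_n) :
  class_C 2 l ->
  dotp u (hessian (l \o A) x *m u) = 'D_(A u) ('D_(A u) l) (A x).
Proof.
move=> Cl; have -> : A u = \sum_i u i 0 *: A (delta_mx i 0).
  rewrite {1}[u]matrix_sum_delta linear_sum; apply: eq_bigr => i _.
  by rewrite big_ord1 linearZ.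
rewrite derive2_sumZ //; apply: eq_bigr => i _.
rewrite mxE mulr_sumr; apply: eq_bigr => j _; rewrite mxE.
(* The first derivative is again a function composed with [A], so the same rule moves the second
   derivative through [A]. *)
have -> : 'D_(delta_mx j 0) (l \o A) = 'D_(A (delta_mx j 0)) l \o A.
  by apply/funext => y; rewrite derive_comp_linear.
by rewrite derive_comp_linear mulrA mulrAC.
Qed.

Theorem corollary3 (R : realType) (c s d' : nat)
  (h : 'cV[R]_d' -> 'cV[R]_s)
  (f : 'M[R]_(c, s) * 'cV[R]_d' -> 'cV[R]_c)
  (f_def : forall (W : 'M[R]_(c, s)) (theta' : 'cV[R]_d'),
      f (W, theta') = W *m h theta')
  (f_smooth : smooth f)
  (l : 'cV[R]_c -> R) (l_smooth : smooth l)
  (L : 'M[R]_(c, s) * 'cV[R]_d' -> R) (L_def : L = l \o f)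
  (W : 'M[R]_(c, s)) (theta' : 'cV[R]_d')
  (V : 'M[R]_(c, s)) (V_sub_W : (V <= W)%MS) :
  dotp (vec V) (hessian_vecW L (W, theta') *m vec V)
  = dotp (V *m h theta') (hessian l (f (W, theta')) *m (V *m h theta')).
Proof.
have [A AE] : exists A : {linear 'cV[R]_(s * c) -> 'cV[R]_c},
    forall w, A w = unvec w *m h theta'.
  pose A (w : 'cV[R]_(s * c)) := unvec w *m h theta'.
  have linA : linear A.
    by move=> a v w; rewrite /A /unvec !linearP /= mulmxDl -scalemxAl.
  pose mA := GRing.isLinear.Build _ _ _ _ A linA.
  pose A' : {linear 'cV[R]_(s * c) -> 'cV[R]_c} := HB.pack A mA.
  by exists A'.
have AvecE B : A (vec B) = B *m h theta' by rewrite AE vecK.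
have LE : (fun w => L (unvec w, theta')) = l \o A.
  by apply/funext => w; rewrite L_def /comp f_def AE.
rewrite /hessian_vecW LE.
have C2 : class_C 2 l := l_smooth 2%N.
rewrite (dotp_hessian_comp_linear A (vec V) (vec W) C2) !AvecE f_def.
(* The Hessian form of [l] itself is the case where [A] is the identity. *)
by rewrite -(dotp_hessian_comp_linear idfun _ _ C2).
Qed.
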